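(* For each integer $n \ge 2$ there exists a constant $C_n > 0$ (depending only on $n$) such that for every integer $N \ge 1$ and all points $x_1,\dots,x_N \in \mathbb{H}^n$, the hyperbolic volume of the (geodesic) convex hull of $\{x_1,\dots,x_N\}$ satisfies $\mathrm{Vol}(\mathrm{Conv}(x_1,\dots,x_N)) < C_n N$.
   Context: $\mathbb{H}^n$ is the $n$-dimensional hyperbolic space (constant curvature $-1$), $\mathrm{Vol}$ is its Riemannian volume measure, and $\mathrm{Conv}(X)$ is the smallest geodesically convex set containing $X$. One may use the Klein model: the open Euclidean unit ball of $\mathbb{R}^n$ with metric $ds^2 = \frac{dx_1^2+\dots+dx_n^2}{1-|x|^2} + \frac{(x_1dx_1+\dots+x_ndx_n)^2}{(1-|x|^2)^2}$ and volume density $(1-|x|^2)^{-(n+1)/2}\,dx$; in this model hyperbolic convex hulls coincide with Euclidean convex hulls. *)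

(* Defs.v *)
From HB Require Import structures.
From mathcomp Require Import all_boot all_order all_algebra.
From mathcomp Require Import all_classical all_reals all_analysis.

Set Implicit Arguments.
Unset Strict Implicit.
Unset Printing Implicit Defensive.

Import Order.TTheory GRing.Theory Num.Theory.
Import numFieldNormedType.Exports.

Local Open Scope classical_set_scope.
Local Open Scope ring_scope.

(* R^n is n.-tuple R, which carries the product of the Borel sigma-algebras. *)
Notation euclid R n := (n.-tuple (measurableTypeR R)).

Section LebesgueTuple.
Context {R : realType}.

Definition tuple_of_pair n (p : measurableTypeR R * euclid R n) :
  euclid R n.+1 := [tuple of p.1 :: p.2].

Fixpoint lebesgue_tuple n : set (euclid R n) -> \bar R :=
  match n return set (euclid R n) -> \bar R with
  | 0 => dirac [tuple]
  | m.+1 => pushforward (lebesgue_measure \x lebesgue_tuple (n := m))%E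
              (@tuple_of_pair m)
  end.
Arguments lebesgue_tuple : clear implicits.

Lemma measurable_tuple_of_pair n : measurable_fun setT (@tuple_of_pair n).
Proof. exact: measurable_cons. Qed.

Let pair_of_tuple n (x : euclid R n.+1) : measurableTypeR R * euclid R n :=
  (thead x, [tuple of behead x]).

Let measurable_pair_of_tuple n : measurable_fun setT (@pair_of_tuple n).
Proof.
apply: measurable_fun_pair; last exact: measurable_behead.
exact: measurable_tnth.
Qed.

Let tuple_of_pairK n : cancel (@tuple_of_pair n) (@pair_of_tuple n).
Proof.
by case=> a x; rewrite /pair_of_tuple /tuple_of_pair theadE; congr pair;
exact/val_inj.
Qed.

Let lebesgue_tuple_sigma_finite_measure n :
  exists m : {sigma_finite_measure set (euclid R n) -> \bar R},
    lebesgue_tuple n = m.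
Proof.
elim: n => [|n [m mE]].
  by exists (dirac ([tuple] : euclid R 0) : {sigma_finite_measure set _ -> \bar R}).
pose P : {measure set (measurableTypeR R * euclid R n)%type -> \bar R} :=
  (@lebesgue_measure R \x m)%E.
have mK := @measurable_tuple_of_pair n.
pose Q := pushforward P (@tuple_of_pair n).
have Qsf : sigma_finite setT Q.
  have /sigma_finiteP[F [FT ndF Ffin]] := sigma_finiteT (@lebesgue_measure R).
  have /sigma_finiteP[G [GT ndG Gfin]] := sigma_finiteT m.
  exists (fun k => @pair_of_tuple n @^-1` (F k `*` G k)).
    rewrite -preimage_bigcup (_ : \bigcup_k _ = setT) ?preimage_setT//.
    rewrite -subTset => -[a x] _.
    have [k _ Fka] : (\bigcup_k F k) a by rewrite -FT.
    have [l _ Glx] : (\bigcup_k G k) x by rewrite -GT.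
    exists (maxn k l) => //; split => /=.
    - by move: a Fka; exact/subsetPset/ndF/leq_maxl.
    - by move: x Glx; exact/subsetPset/ndG/leq_maxr.
  move=> k; have [mF Fk] := Ffin k; have [mG Gk] := Gfin k; split.
    rewrite -[X in measurable X]setTI; apply: measurable_pair_of_tuple => //.
    exact: measurableX.
  rewrite /Q /pushforward -comp_preimage (_ : _ \o _ = id); last first.
    by apply/funext => p /=; exact: tuple_of_pairK.
  rewrite preimage_id [ltLHS]product_measure1E//.
  by rewrite lte_mul_pinfty// ge0_fin_numE.
pose mQ : {measure set (euclid R n.+1) -> \bar R} :=
  measure_function_pushforward__canonical__measure_function_Measure P mK.
have sQ := @Measure_isSigmaFinite.Build _ _ R mQ Qsf.
pose q : {sigma_finite_measure set (euclid R n.+1) -> \bar R} :=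
  HB.pack (Measure.sort mQ) (Measure.class mQ) sQ.
by exists q; rewrite /= mE.
Qed.

Let lebesgue_tuple0 n : lebesgue_tuple n set0 = 0%E.
Proof. by have [m ->] := lebesgue_tuple_sigma_finite_measure n. Qed.

Let lebesgue_tuple_ge0 n A : (0 <= lebesgue_tuple n A)%E.
Proof. by have [m ->] := lebesgue_tuple_sigma_finite_measure n. Qed.

Let lebesgue_tuple_sigma_additive n : semi_sigma_additive (lebesgue_tuple n).
Proof.
have [m ->] := lebesgue_tuple_sigma_finite_measure n.
exact: measure_semi_sigma_additive.
Qed.

HB.instance Definition _ n := isMeasure.Build _ _ _ (lebesgue_tuple n)
  (lebesgue_tuple0 n) (@lebesgue_tuple_ge0 n) (@lebesgue_tuple_sigma_additive n).

Let lebesgue_tuple_sigma_finite n : sigma_finite setT (lebesgue_tuple n).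
Proof. by have [m ->] := lebesgue_tuple_sigma_finite_measure n; exact: sigma_finiteT. Qed.

HB.instance Definition _ n := Measure_isSigmaFinite.Build _ _ _
  (lebesgue_tuple n) (@lebesgue_tuple_sigma_finite n).

Lemma lebesgue_tuple_box n (A : 'I_n -> set (measurableTypeR R)) :
  (forall i, measurable (A i)) ->
  lebesgue_tuple n [set x | forall i, A i (tnth x i)] =
  (\prod_(i < n) lebesgue_measure (A i))%E.
Proof.
elim: n A => [|n IHn] A mA /=.
  by rewrite big_ord0 diracE mem_set//= => -[].
rewrite big_ord_recl -IHn//.
rewrite -product_measure1E//; last first.
  rewrite (_ : [set x | _] =
      \bigcap_(i in [set: 'I_n]) ((@tnth n (measurableTypeR R))^~ i @^-1` A (lift ord0 i))).
    apply: fin_bigcap_measurable => // i _.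
    by rewrite -[X in measurable X]setTI; exact: measurable_tnth.
  by apply/seteqP; split => x /= xA i; [move=> _|]; exact: xA.
rewrite /pushforward; congr (product_measure1 _ _ _); apply/seteqP; split => -[a x] /=.
  move=> ax; split => /= [|i]; first exact: (ax ord0).
  by have := ax (lift ord0 i); rewrite tnthS.
move=> [aA xA] i; case: (unliftP ord0 i) => [j ->|->] //=.
by rewrite tnthS; exact: xA.
Qed.

End LebesgueTuple.
Arguments lebesgue_tuple {R} n.

Section KleinModel.
Context {R : realType} {n : nat}.

Definition dotp (x y : euclid R n) : R := \sum_(i < n) tnth x i * tnth y i.

Record hyperbolic : Type :=
  Hyperbolic { klein : euclid R n; klein_ball : dotp klein klein < 1 }.

Definition arcosh (u : R) : R := ln (u + Num.sqrt (u ^+ 2 - 1)).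

(* Distance function of the Riemannian metric
   |dx|^2 / (1 - |x|^2) + (x . dx)^2 / (1 - |x|^2)^2. *)
Definition hdist (x y : hyperbolic) : R :=
  arcosh ((1 - dotp (klein x) (klein y)) /
    Num.sqrt ((1 - dotp (klein x) (klein x)) * (1 - dotp (klein y) (klein y)))).

(* gam is a unit-speed minimizing geodesic from x to y; only its values on
   [0, hdist x y] matter. *)
Definition geodesic (x y : hyperbolic) (gam : R -> hyperbolic) : Prop :=
  [/\ gam 0 = x, gam (hdist x y) = y &
    {in `[0, hdist x y] &, forall s t, hdist (gam s) (gam t) = `|s - t|}].

Definition geodesically_convex (A : set hyperbolic) : Prop :=
  forall x y gam, A x -> A y -> geodesic x y gam ->
    {in `[0, hdist x y], forall t, A (gam t)}.

Definition hconv (X : set hyperbolic) : set hyperbolic :=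
  smallest geodesically_convex X.

Lemma hconv_geodesically_convex (X : set hyperbolic) :
  geodesically_convex (hconv X).
Proof.
move=> x y gam Xx Xy xy t t01 A [cA XA].
by apply: (cA x y gam _ _ xy) t t01; [exact: Xx|exact: Xy].
Qed.

Definition hvol (A : set hyperbolic) : \bar R :=
  (\int[lebesgue_tuple n]_(x in klein @` A)
    ((1 - dotp x x) `^ (- (n.+1%:R / 2)))%:E)%E.

End KleinModel.
Arguments hyperbolic : clear implicits.

(* Main.v *)
(** Pass to the paraboloid model: for a point (s, y') of the Klein ball put
    p = y' / (1 - s) and z = (1 + s) / (1 - s), so that z - |p|^2 is the squared
    height in the upper half-space model, hyperplanes stay affine, and the
    volume is dp dz / (2 (z - |p|^2)^((n+1)/2)) with p in R^m, m = n - 1.  If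
    (p, z) is a convex combination, with weights mu_l, of points (p_l, z_l)
    with z_l >= |p_l|^2, then z - |p|^2 >= sum mu_l |p_l - p|^2.

    Let p_k be the point nearest to p, p = p_k + r theta, and let tau be the
    distance from p_k to the boundary of its Voronoi cell in the direction
    theta, so that <p_l - p_k, theta> <= |p_l - p_k|^2 / (2 tau) for all l.
    Averaging over mu yields r <= (sum mu_l |p_l - p_k|^2) / (2 tau), hence
    z - |p|^2 >= 2 r tau - r^2 >= r tau.  Integrating the volume over z, then
    over r <= tau and over the directions theta, bounds the contribution of
    each Voronoi cell by a constant, since the integral of
    (r tau)^(-m/2) r^(m-1) dr over [0, tau] does not depend on tau. *)

Require Import Defs.
From HB Require Import structures.
From mathcomp Require Import all_boot all_order all_algebra.
From mathcomp Require Import all_classical all_reals all_analysis.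
From mathcomp Require Import measurable_realfun.
From mathcomp Require Import ring lra.

Import Order.TTheory GRing.Theory Num.Theory.
Import numFieldNormedType.Exports.
Local Open Scope classical_set_scope.
Local Open Scope ring_scope.

Set Implicit Arguments.
Unset Strict Implicit.
Unset Printing Implicit Defensive.

(** * Integration *)

(** A nonnegative integral is a supremum over simple functions, and every simple function below [f]
    on [D] is below [g] on [E]. Sets and functions are arbitrary, so this applies to the hull, whose
    measurability is never established. *)
Lemma ge0_le_integral_subset d (T : measurableType d) (R : realType)
    (mu : {measure set T -> \bar R}) (D E : set T) (f g : T -> \bar R) :
  (forall x, D x -> 0 <= f x)%E -> (forall x, E x -> 0 <= g x)%E ->
  (forall x, D x -> E x /\ f x <= g x)%E ->
  (\int[mu]_(x in D) f x <= \int[mu]_(x in E) g x)%E.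
Proof.
move=> f0 g0 fg; rewrite !ge0_integralE//.
apply: ge_ereal_sup => _ [h hf <-]; apply: ereal_sup_ubound.
exists h => // x; apply: le_trans (hf x) _; rewrite !patchE.
case: ifPn => [/set_mem Dx|_]; first by have [Ex ?] := fg _ Dx; rewrite mem_set.
by case: ifPn => // /set_mem /g0.
Qed.

(** Lebesgue measure is [a] times its pushforward under [x -> a * x + b]: the two agree on half-open
    intervals, hence on all measurable sets. *)
Lemma integral_affine (R : realType) (a b : R) (f : R -> \bar R) :
  0 < a -> measurable_fun setT f -> (forall x, 0 <= f x)%E ->
  (\int[lebesgue_measure]_x f x =
   a%:E * \int[lebesgue_measure]_x f (a * x + b)%R)%E.
Proof.
move=> a0 mf f0.
pose phi : measurableTypeR R -> measurableTypeR R := fun x => a * x + b.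
have mphi : measurable_fun setT phi.
  by apply: measurable_funD => //; exact: mulrl_measurable.
pose P : {measure set (measurableTypeR R) -> \bar R} :=
  measure_function_pushforward__canonical__measure_function_Measure
    (@lebesgue_measure R) mphi.
pose k : {nonneg R} := NngNum (ltW a0).
have mE A : measurable A -> lebesgue_measure A = mscale k P A.
  apply: lebesgue_measure_unique => _ [[u v] _ <-] /=.
  rewrite /mscale /= /pushforward.
  have -> : phi @^-1` `]u, v]%classic = `]((u - b) / a), ((v - b) / a)]%classic.
    apply/seteqP; split => x /=; rewrite /phi !in_itv/= ltr_pdivrMr// ler_pdivlMr//
      ltrBlDr lerBrDr mulrC//.
  rewrite !lebesgue_measure_itv/= !lte_fin ltr_pM2r ?invr_gt0// ltrD2r.
  case: ifPn => _; last by rewrite mule0.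
  by rewrite -!EFinD -EFinM; congr EFin; field; rewrite gt_eqF.
rewrite (@eq_measure_integral _ _ _ _ (mscale k P)); last by move=> A mA _; exact: mE.
rewrite ge0_integral_mscale//; congr (_ * _)%E.
by rewrite ge0_integral_pushforward.
Qed.

Lemma integral_lebesgue_tupleS (R : realType) n (f : euclid R n.+1 -> \bar R) :
  measurable_fun setT f -> (forall x, 0 <= f x)%E ->
  (\int[lebesgue_tuple n.+1]_x f x = \int[lebesgue_measure]_s
     \int[lebesgue_tuple n]_w f (tuple_of_pair (s, w)))%E.
Proof.
move=> mf f0.
have := @ge0_integral_pushforward _ _ _ _ _ _ (@measurable_tuple_of_pair R n)
  (lebesgue_measure \x lebesgue_tuple n)%E setT f measurableT mf (fun x _ => f0 x).
have mfc : measurable_fun setT (f \o @tuple_of_pair R n).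
  by apply: (measurableT_comp mf); exact: measurable_tuple_of_pair.
rewrite preimage_setT => ->.
by rewrite (fubini_tonelli1 (f \o @tuple_of_pair R n)) //= => x; exact: f0.
Qed.

Lemma measurable_tuple_of_pair_comp (R : realType) n d (T : measurableType d)
    (f : T -> R) (g : T -> euclid R n) :
  measurable_fun setT f -> measurable_fun setT g ->
  measurable_fun setT (fun t => tuple_of_pair (f t, g t)).
Proof. by move=> mf mg; exact: measurable_cons. Qed.

Definition homothety (R : realType) n (a : R) (b w : euclid R n) : euclid R n :=
  [tuple a * tnth w i + tnth b i | i < n].

Lemma measurable_homothety (R : realType) n (a : R) (b : euclid R n) :
  measurable_fun setT (homothety a b).
Proof.
apply/measurable_fun_tnthP => i.
rewrite (_ : _ \o _ = fun w => a * tnth w i + tnth b i); last first.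
  by apply/funext => w; rewrite /= tnth_mktuple.
apply: measurable_funD => //; apply: measurable_funM => //.
exact: measurable_tnth.
Qed.

(** Induction on the dimension: Tonelli splits off the first coordinate, [integral_affine] rescales
    it, and the induction hypothesis rescales the others. *)
Lemma integral_homothety (R : realType) n (a : R) (b : euclid R n)
    (f : euclid R n -> \bar R) :
  0 < a -> measurable_fun setT f -> (forall x, 0 <= f x)%E ->
  (\int[lebesgue_tuple n]_w f w =
   (a ^+ n)%:E * \int[lebesgue_tuple n]_w f (homothety a b w))%E.
Proof.
move=> a0; elim: n => [|n IHn] in b f *; move=> mf f0.
  rewrite expr0 mul1e; apply: eq_integral => w _.
  by rewrite [homothety a b w]tuple0 (tuple0 w).
have mcons := @measurable_tuple_of_pair R n.
have mhom := measurable_homothety a b.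
rewrite !integral_lebesgue_tupleS//; last exact: measurableT_comp.
pose b0 := thead b; pose b' : euclid R n := [tuple of behead b].
have homE s w : homothety a b (tuple_of_pair (s, w)) =
    tuple_of_pair (a * s + b0, homothety a b' w).
  apply/eq_from_tnth => i; rewrite tnth_mktuple.
  case: (unliftP ord0 i) => [j ->|->]; last by rewrite !tnth0.
  rewrite !tnthS tnth_mktuple tnth_behead; congr (_ * _ + tnth b _).
  by apply/val_inj; rewrite /= inordK // ltnS.
under eq_integral => s _.
  rewrite (IHn b'); last 2 first.
  - apply: (measurableT_comp mf); exact: measurable_tuple_of_pair_comp.
  - by move=> w; exact: f0.
  over.
have mF : measurable_fun setT (fun s : measurableTypeR R =>
    \int[lebesgue_tuple n]_w f (tuple_of_pair (s, homothety a b' w)))%E.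
  apply: (@measurable_fun_fubini_tonelli_F _ _ (measurableTypeR R) (euclid R n) R
   (lebesgue_tuple n) (fun z => f (tuple_of_pair (z.1, homothety a b' z.2)))) => //.
  apply: (measurableT_comp mf); apply: measurable_tuple_of_pair_comp => //.
  exact: measurableT_comp (measurable_homothety _ _) _.
have F0 (s : R) : (0 <= \int[lebesgue_tuple n]_w
    f (tuple_of_pair (s, homothety a b' w)))%E by exact: integral_ge0.
rewrite ge0_integralZl//; last by rewrite lee_fin exprn_ge0// ltW.
rewrite (integral_affine b0 a0 mF F0) muleA -EFinM -exprSr; congr (_ * _)%E.
apply: eq_integral => s _; apply: eq_integral => w _.
by rewrite homE.
Qed.

Lemma measurable_funV d (T : measurableType d) (R : realType) (f : T -> R) :
  measurable_fun setT f -> measurable_fun setT (fun x => (f x)^-1).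
Proof.
move=> mf.
(* The power [-1] agrees with the inverse on nonnegative arguments, hence the square; the factor
   [f x] makes both sides 0 where [f x] vanishes. *)
have -> : (fun x => (f x)^-1) = (fun x => f x * (f x ^+ 2) `^ (-1)).
  apply/funext => x; rewrite powR_inv1 ?sqr_ge0//.
  have [->|fx0] := eqVneq (f x) 0; first by rewrite invr0 mul0r.
  by field.
apply: measurable_funM => //; apply: measurableT_comp (measurable_powR _) _.
exact: measurable_funX.
Qed.

Lemma measurable_fun_sqrt d (T : measurableType d) (R : realType) (f : T -> R) :
  measurable_fun setT f -> measurable_fun setT (fun x => Num.sqrt (f x)).
Proof.
move=> mf; apply: (measurableT_comp _ mf).
apply: continuous_measurable_fun; exact: sqrt_continuous.
Qed.

Lemma measurable_dotp (R : realType) n d (T : measurableType d)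
    (f g : T -> euclid R n) :
  measurable_fun setT f -> measurable_fun setT g ->
  measurable_fun setT (fun x => dotp (f x) (g x)).
Proof.
move=> mf mg; apply: measurable_sum => i.
by apply: measurable_funM; apply: (measurableT_comp (measurable_tnth i)).
Qed.

Section Dotp.
Context {R : realType} {n : nat}.
Implicit Types (x y : euclid R n) (a : R).

Definition origin : euclid R n := [tuple 0 | _ < n].

Lemma tnth_origin i : tnth origin i = 0. Proof. by rewrite tnth_mktuple. Qed.

Lemma dotp_ge0 x : 0 <= dotp x x.
Proof. by apply: sumr_ge0 => i _; rewrite -expr2 sqr_ge0. Qed.

Lemma sqr_tnth_le_dotp x i : tnth x i ^+ 2 <= dotp x x.
Proof.
rewrite /dotp (bigD1 i)//= -expr2 lerDl.
by apply: sumr_ge0 => j _; rewrite -expr2 sqr_ge0.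
Qed.

Lemma dotp_eq0 x : dotp x x = 0 -> x = origin.
Proof.
move=> x0; apply/eq_from_tnth => i; rewrite tnth_origin.
by apply/eqP; rewrite -sqrf_eq0 eq_le sqr_ge0 andbT -x0 sqr_tnth_le_dotp.
Qed.

Lemma dotp_scale a x : dotp (homothety a origin x) (homothety a origin x) =
  a ^+ 2 * dotp x x.
Proof.
rewrite /dotp mulr_sumr; apply: eq_bigr => i _.
by rewrite !tnth_mktuple; ring.
Qed.

End Dotp.

(** The ball lies in a cube of side [2 * r]. *)
Lemma lebesgue_tuple_ball_le (R : realType) n (r : R) : 0 <= r ->
  (lebesgue_tuple n [set x | (dotp x x < r ^+ 2)%R] <= ((2 * r) ^+ n)%:E)%E.
Proof.
move=> r0.
have mB : measurable [set x : euclid R n | forall i, `[- r, r]%classic (tnth x i)].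
  rewrite (_ : [set x | _] =
      \bigcap_(i in [set: 'I_n]) ((@tnth n (measurableTypeR R))^~ i @^-1` `[- r, r]%classic)).
    apply: fin_bigcap_measurable => // i _.
    by rewrite -[X in measurable X]setTI; exact: measurable_tnth.
  by apply/seteqP; split => x /= xA i; [move=> _|]; exact: xA.
have : lebesgue_tuple n [set x : euclid R n | forall i, `[- r, r]%classic (tnth x i)] =
    ((2 * r) ^+ n)%:E.
  rewrite (@lebesgue_tuple_box _ _ (fun=> `[- r, r]%classic)) => [|i]; last exact: measurable_itv.
  rewrite (eq_bigr (fun=> (2 * r)%:E)) => [|i _].
    by rewrite -(big_morph EFin (fun _ _ => erefl) erefl) prodr_const card_ord.
  rewrite lebesgue_measure_itv/= lte_fin.
  case: ifPn => [_|]; first by rewrite -EFinD opprK mulr2n mulrDl mul1r.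
  by move=> rr; congr EFin; lra.
move=> <-; apply: le_measure; rewrite ?inE//.
  rewrite [X in measurable X](_ : _ =
      setT `&` (fun x : euclid R n => dotp x x) @^-1` `]-oo, (r ^+ 2)[%classic).
    by apply: measurable_dotp => //; exact: measurable_itv.
  by apply/seteqP; split => x /=; rewrite in_itv/=; [split|case].
move=> x /= xr i; rewrite in_itv/= -ler_norml.
rewrite -(@ler_sqr R) ?nnegrE//.
by rewrite real_normK ?num_real// (le_trans (sqr_tnth_le_dotp _ _))// ltW.
Qed.

(** * Radial integrals *)

Section ConeIntegral.
Context {R : realType} {m : nat}.
Variable rho : euclid R m.+1 -> R.
Hypothesis mrho : measurable_fun setT rho.
Hypothesis rhoZ : forall a w, 0 < a -> rho (homothety a origin w) = a * rho w.

Local Notation E := (euclid R m.+1).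
Definition norm2 (w : E) := Num.sqrt (dotp w w).
(** For the gauge of a Voronoi cell, [rho w = r / tau] in the notation of the overview, whose
    dimension m is [m.+1] here. So this is [(r tau)^(-(m+1)/2)], restricted to the cell
    [rho <= 1]. *)
Definition cone_density (w : E) : R :=
  if (0 < norm2 w) && ((0 < rho w) && (rho w <= 1))
  then (Num.sqrt (rho w) / norm2 w) ^+ m.+1 else 0.
(** Spreads [cone_density] over the scales [t] comparable to [sqrt |w|], with measure [dt / t].
    Averaging over scales takes the place of polar coordinates. *)
Definition scale_kernel (z : measurableTypeR R * E) : R :=
  if (0 < (z.1 : R)) && (((z.1 : R) ^+ 2 <= norm2 z.2) && (norm2 z.2 < 4 * (z.1 : R) ^+ 2))
  then (z.1 : R)^-1 * cone_density z.2 else 0.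
(** Majorant of [scale_kernel] after the substitution [w = t^2 v], Jacobian included. *)
Definition scaled_density (z : measurableTypeR R * E) : R :=
  if (0 < (z.1 : R)) && ((dotp z.2 z.2 < 4 ^+ 2) &&
     ((0 < rho z.2) && ((z.1 : R) ^+ 2 * rho z.2 <= 1)))
  then (z.1 : R) ^+ m * Num.sqrt (rho z.2) ^+ m.+1 else 0.

Lemma measurable_norm2 : measurable_fun setT norm2.
Proof. by apply: measurable_fun_sqrt; exact: measurable_dotp. Qed.

Lemma measurable_cone_density : measurable_fun setT cone_density.
Proof.
have mn := measurable_norm2.
apply: measurable_fun_ifT => //.
  apply: measurable_and; first exact: measurable_fun_ltr.
  by apply: measurable_and; [exact: measurable_fun_ltr|exact: measurable_fun_ler].
apply: measurable_funX; apply: measurable_funM; first exact: measurable_fun_sqrt.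
exact: measurable_funV.
Qed.

Lemma measurable_scale_kernel : measurable_fun setT scale_kernel.
Proof.
have mn := measurable_norm2; have mh := measurable_cone_density.
have mnm2 : measurable_fun setT (fun z : measurableTypeR R * E => norm2 z.2).
  exact: measurableT_comp.
have m1 : measurable_fun setT (fun z : measurableTypeR R * E => z.1 : R).
  exact: measurable_fst.
have m2 : measurable_fun setT (fun z : measurableTypeR R * E => z.1 ^+ 2 : R).
  exact: measurable_funX.
apply: measurable_fun_ifT => //.
  apply: measurable_and; first exact: measurable_fun_ltr.
  apply: measurable_and; first exact: measurable_fun_ler.
  by apply: measurable_fun_ltr => //; exact: measurable_funM.
apply: measurable_funM; first exact: (measurable_funV m1).
exact: (measurableT_comp measurable_cone_density).
Qed.

Lemma measurable_scaled_density : measurable_fun setT scaled_density.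
Proof.
have m1 : measurable_fun setT (fun z : measurableTypeR R * E => z.1 : R).
  exact: measurable_fst.
have mr2 : measurable_fun setT (fun z : measurableTypeR R * E => rho z.2).
  exact: measurableT_comp.
have m2 : measurable_fun setT (fun z : measurableTypeR R * E => z.1 ^+ 2 : R).
  exact: measurable_funX.
apply: measurable_fun_ifT => //.
  apply: measurable_and; first exact: measurable_fun_ltr.
  apply: measurable_and.
    by apply: measurable_fun_ltr => //; exact: measurable_dotp.
  apply: measurable_and; first exact: measurable_fun_ltr.
  by apply: measurable_fun_ler => //; exact: measurable_funM.
apply: measurable_funM; first exact: measurable_funX.
by apply: measurable_funX; exact: measurable_fun_sqrt.
Qed.

Lemma cone_density_ge0 w : 0 <= cone_density w.
Proof.
by rewrite /cone_density; case: ifPn => // _; rewrite exprn_ge0// divr_ge0// sqrtr_ge0.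
Qed.

Lemma scale_kernel_ge0 z : 0 <= scale_kernel z.
Proof.
have h0 := cone_density_ge0.
rewrite /scale_kernel; case: ifPn => // /andP[z0 _].
by rewrite mulr_ge0// invr_ge0 ltW.
Qed.

Lemma scaled_density_ge0 z : 0 <= scaled_density z.
Proof.
rewrite /scaled_density; case: ifPn => // /andP[z0 _].
by rewrite mulr_ge0// exprn_ge0// ?sqrtr_ge0// ltW.
Qed.

(* For w <> 0 the scales t with t^2 <= |w| < 4 t^2 have dt/t-measure at
   least 1/2. *)
Lemma cone_density_le_scale_kernel w :
  ((cone_density w)%:E <=
   2%:E * \int[lebesgue_measure]_t (scale_kernel (t, w))%:E)%E.
Proof.
have h0 := cone_density_ge0; have k0 := scale_kernel_ge0.
have [nw|nw] := boolP (0 < norm2 w); last first.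
  rewrite {1}/cone_density (negbTE nw)/= mule_ge0// integral_ge0// => t _.
  by rewrite lee_fin scale_kernel_ge0.
(* Every [t] in []u / 2, u]] passes both cut-offs and satisfies [1 / t >= 1 / u]; the interval has
   length [u / 2], which gives the mass 1/2. *)
pose u := Num.sqrt (norm2 w).
have u0 : 0 < u by rewrite sqrtr_gt0.
have u2 : u ^+ 2 = norm2 w by rewrite sqr_sqrtr// ltW.
have <- : (2%:E * \int[lebesgue_measure]_(t in `](u / 2)%R, u]) (cst (u^-1 * cone_density w)%:E t) =
    (cone_density w)%:E)%E.
  rewrite integral_cst//= lebesgue_measure_itv/= lte_fin ifT; last by lra.
  by rewrite -EFinD -!EFinM; congr EFin; field; rewrite gt_eqF.
apply: lee_wpmul2l => //.
apply: ge0_le_integral_subset => t.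
- by rewrite lee_fin mulr_ge0// invr_ge0 ltW.
- by rewrite lee_fin.
rewrite /= in_itv/= => /andP[ut tu]; split => //.
have t0 : 0 < t by apply: lt_trans ut; rewrite divr_gt0.
rewrite lee_fin /scale_kernel /= t0/= -u2 ifT; last first.
  by apply/andP; split; nra.
by apply: ler_wpM2r => //; rewrite lef_pV2.
Qed.

(** Both [rho] and the norm scale by [t^2], so [sqrt rho / norm2] scales by [1 / t]. The powers of
    [t] combine to [2(m+1) - 1 - (m+1) = m], and the cut-off [norm2 v >= 1] allows the denominator
    to be dropped. *)
Lemma scale_kernel_scale t v : 0 < t ->
  (t ^+ 2) ^+ m.+1 * scale_kernel (t, homothety (t ^+ 2) origin v) <= scaled_density (t, v).
Proof.
have G0 := scaled_density_ge0.
move=> t0; have t20 : 0 < t ^+ 2 by rewrite exprn_gt0.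
rewrite /scale_kernel /= t0 /= /norm2 dotp_scale sqrtrM ?sqr_ge0// sqrtr_sqr.
rewrite (gtr0_norm t20) -/(norm2 v).
case: ifPn => [|_]; last by rewrite mulr0.
rewrite ler_pMr// [ltLHS]mulrC ltr_pM2r// => /andP[v1 v4].
have v0 : 0 < norm2 v by lra.
rewrite /cone_density rhoZ//; case: ifPn => [|_]; last by rewrite !mulr0.
move=> /and3P[_]; rewrite pmulr_rgt0// => r0 r1.
rewrite /scaled_density /= t0 r0 r1 /= ifT; last first.
  rewrite andbT -[dotp v v]sqr_sqrtr ?dotp_ge0// -/(norm2 v).
  by rewrite ltr_sqr// nnegrE// ltW.
rewrite /norm2 dotp_scale (sqrtrM (dotp v v) (sqr_ge0 (t ^+ 2))).
rewrite (sqrtrM (rho v) (sqr_ge0 t)) !sqrtr_sqr (gtr0_norm t20) (gtr0_norm t0).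
rewrite -/(norm2 v).
have -> : (t ^+ 2) ^+ m.+1 * (t^-1 * (t * Num.sqrt (rho v) / (t ^+ 2 * norm2 v)) ^+ m.+1)
  = t ^+ m * (Num.sqrt (rho v) / norm2 v) ^+ m.+1.
  have -> : t * Num.sqrt (rho v) / (t ^+ 2 * norm2 v) = t^-1 * (Num.sqrt (rho v) / norm2 v).
    by field; rewrite !gt_eqF.
  rewrite [(t^-1 * _) ^+ _]exprMn exprVn -exprM mulnC exprM.
  set X := (_ / _) ^+ _.
  by rewrite [t ^+ m.+1]exprS; field; rewrite ?expf_neq0 ?gt_eqF//.
rewrite ler_wpM2l ?exprn_ge0 ?(ltW t0)//.
rewrite lerXn2r ?nnegrE ?divr_ge0 ?sqrtr_ge0//.
by rewrite ler_pdivrMr// ler_peMr// sqrtr_ge0.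
Qed.

(** On the support [t * sqrt (rho v) <= 1], so the integrand is at most [sqrt (rho v)] on an
    interval of length [1 / sqrt (rho v)]. This is where the dependence on [rho] cancels. *)
Lemma integral_scaled_density_le v : (\int[lebesgue_measure]_t (scaled_density (t, v))%:E <=
  (\1_[set v : E | (dotp v v < 4 ^+ 2)%R] v)%:E)%E.
Proof.
have G0 := scaled_density_ge0.
have [/andP[v4 r0]|] := boolP ((dotp v v < 4 ^+ 2) && (0 < rho v)); last first.
  move=> nv; rewrite integral0_eq ?lee_fin// => t _.
  rewrite /scaled_density /=; case: ifPn => // /and4P[_ a b _].
  by rewrite a b in nv.
rewrite indicE mem_set//=.
pose c := (Num.sqrt (rho v))^-1.
have s0 : 0 < Num.sqrt (rho v) by rewrite sqrtr_gt0.
have c0 : 0 < c by rewrite invr_gt0.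
have <- : (\int[lebesgue_measure]_(t in `[0%R, c]) (cst (Num.sqrt (rho v))%:E t) = 1%:E)%E.
  rewrite integral_cst//= lebesgue_measure_itv/= lte_fin c0.
  by rewrite -EFinD -!EFinM subr0 divff// gt_eqF.
rewrite integral_mkcond [leRHS]integral_mkcond.
apply: ge0_le_integral_subset => // t _.
- by rewrite patch_setT lee_fin.
- by rewrite patchE; case: ifPn => _ //; rewrite lee_fin ltW.
split=> //; rewrite patch_setT patchE /=.
rewrite /scaled_density /=; case: ifPn => [/and4P[t0 _ _ tr]|_]; last first.
  by case: ifPn => _ //; rewrite lee_fin ltW.
have tc : t <= c.
  rewrite /c -[leRHS]mul1r ler_pdivlMr//.
  rewrite -(@ler_sqr R) ?nnegrE ?mulr_ge0 ?sqrtr_ge0 ?(ltW t0)//.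
  by rewrite expr1n exprMn sqr_sqrtr ?(ltW r0).
rewrite mem_set/= ?in_itv/= ?(ltW t0)// lee_fin.
rewrite exprS mulrCA ler_piMr ?(ltW s0)// -exprMn exprn_ile1//.
  by rewrite mulr_ge0// ltW.
by rewrite -ler_pdivlMr// mul1r.
Qed.

(** Average over the scales, exchange the integrals, substitute [w = t^2 v] for fixed [t], exchange
    back and integrate over [t] first. What remains is the volume of the ball of radius 4, at most
    [8 ^ m.+1]; the factor 2 makes up for the mass 1/2 of the scales. *)
Lemma cone_integral_le :
  (\int[lebesgue_tuple m.+1]_w (cone_density w)%:E <= (2 * 8 ^+ m.+1)%:E)%E.
Proof.
have h0 := cone_density_ge0; have k0 := scale_kernel_ge0.
have G0 := scaled_density_ge0; have mk := measurable_scale_kernel.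
have mG := measurable_scaled_density.
have mkE : measurable_fun setT (EFin \o scale_kernel) by exact/measurable_EFinP.
have mGE : measurable_fun setT (EFin \o scaled_density) by exact/measurable_EFinP.
have kE0 z : (0 <= (EFin \o scale_kernel) z)%E by rewrite lee_fin.
have GE0 z : (0 <= (EFin \o scaled_density) z)%E by rewrite lee_fin.
apply: (@le_trans _ _ (\int[lebesgue_tuple m.+1]_w
    (2%:E * \int[lebesgue_measure]_t (scale_kernel (t, w))%:E))%E).
  apply: ge0_le_integral_subset => // w _.
  - by rewrite lee_fin.
  - by rewrite mule_ge0// integral_ge0// => t _; rewrite lee_fin.
  - by split=> //; exact: cone_density_le_scale_kernel.
rewrite ge0_integralZl//; last 2 first.
- exact: (measurable_fun_fubini_tonelli_G (EFin \o scale_kernel)).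
- by move=> w _; rewrite integral_ge0// => t _; rewrite lee_fin.
rewrite EFinM; apply: lee_wpmul2l => //.
rewrite -(fubini_tonelli (EFin \o scale_kernel))//.
apply: (@le_trans _ _ (\int[lebesgue_measure]_t
    (\int[lebesgue_tuple m.+1]_v (scaled_density (t, v))%:E))%E).
  apply: ge0_le_integral_subset => // t _.
  - by apply: integral_ge0 => w _.
  - by apply: integral_ge0 => w _; exact: (GE0 (t, w)).
  split=> //; have [t0|t0] := ltP 0 t; last first.
    rewrite integral0_eq; first by apply: integral_ge0 => w _; exact: (GE0 (t, w)).
    by move=> w _; rewrite /= /scale_kernel /= ltNge t0.
  have mkt : measurable_fun setT (fun w => (EFin \o scale_kernel) (t, w)).
    exact: (measurableT_comp mkE).
  have t20 : 0 < t ^+ 2 by rewrite exprn_gt0.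
  rewrite (integral_homothety origin t20 mkt (fun w => kE0 _)).
  have mkt' : measurable_fun setT
      (fun w => (EFin \o scale_kernel) (t, homothety (t ^+ 2) origin w)).
    by apply: (measurableT_comp mkt); exact: measurable_homothety.
  have t2m : 0 <= (t ^+ 2) ^+ m.+1 by rewrite exprn_ge0// exprn_ge0// ltW.
  rewrite -(ge0_integralZl_EFin _ measurableT (fun w _ => kE0 _) mkt' t2m).
  apply: ge0_le_integral_subset => // w _.
  - by rewrite -EFinM lee_fin mulr_ge0// exprn_ge0// exprn_ge0// ltW.
  - exact: (GE0 (t, w)).
  by split=> //; rewrite /= -EFinM lee_fin scale_kernel_scale.
rewrite (fubini_tonelli (EFin \o scaled_density))//.
apply: (@le_trans _ _ (\int[lebesgue_tuple m.+1]_v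
  (\1_[set v : E | (dotp v v < 4 ^+ 2)%R] v)%:E)%E).
  apply: ge0_le_integral_subset => // w _.
  - by apply: integral_ge0 => t _; exact: (GE0 (t, w)).
  - by split=> //; exact: integral_scaled_density_le.
rewrite integral_indic//= ?setIT.
  have := @lebesgue_tuple_ball_le R m.+1 4 (ler0n _ _).
  by rewrite (_ : 2 * 4 = 8 :> R)//; lra.
rewrite [X in measurable X](_ : _ =
    setT `&` (fun x : E => dotp x x) @^-1` `]-oo, (4 ^+ 2)[%classic).
  by apply: measurable_dotp => //; exact: measurable_itv.
by apply/seteqP; split => x /=; rewrite in_itv/=; [split|case].
Qed.

End ConeIntegral.

(** * Vertical integrals *)

Section VerticalIntegral.
Context {R : realType}.
Variables (c : R).

(** With [c = 1 + |p|^2] this is [z - |p|^2] of the overview, because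
    [z = (1 + s) / (1 - s) = 2 / (1 - s) - 1]. *)
Definition height (s : R) : R := 2 / (1 - s) - c.

Lemma is_derive_onemV (s : R) : s < 1 ->
  is_derive s (1 : R) (fun x : R => (1 - x)^-1) ((1 - s) ^- 2).
Proof.
move=> s1; have s1N : 1 - s != 0 by rewrite gt_eqF// subr_gt0.
have d1 : is_derive s (1 : R) (fun x : R => 1 - x) (-1).
  by apply: is_derive_eq; rewrite add0r mul1r.
have := @is_deriveV _ (fun x : R => 1 - x) s _ _ s1N d1.
by rewrite /GRing.scale/= mulrN1 opprK.
Qed.

Lemma is_derive_height_powR (e s : R) : s < 1 -> 0 < height s ->
  is_derive s (1 : R) (fun x => height x `^ e)
    (e * height s `^ (e - 1) * (2 * (1 - s) ^- 2)).
Proof.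
move=> s1 hs; have d1 := is_derive_onemV s1.
have dh : is_derive s (1 : R) height (2 * (1 - s) ^- 2).
  by apply: is_derive_eq; rewrite ?subr0.
exact: (@is_derive1_comp _ (@powR R ^~ e) height s _ _ (is_derive1_powR e hs) dh).
Qed.

Lemma continuous_height_density (e s : R) : s < 1 -> 0 < height s ->
  {for s, continuous (fun x : R => (1 - x) ^- 2 * height x `^ e)}.
Proof.
move=> s1 hs.
have d1 := is_derive_onemV s1; have d2 := is_derive_height_powR e s1 hs.
have c1 : {for s, continuous (fun x : R => (1 - x)^-1)}.
  by apply: differentiable_continuous; apply/derivable1_diffP; case: d1.
have c2 : {for s, continuous (fun x => height x `^ e)}.
  by apply: differentiable_continuous; apply/derivable1_diffP; case: d2.
have -> : (fun x : R => (1 - x) ^- 2 * height x `^ e) =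
    (fun x : R => (1 - x)^-1 * (1 - x)^-1 * height x `^ e).
  by apply/funext => x; rewrite -exprVn expr2.
by apply: continuousM => //; exact: continuousM.
Qed.

Lemma height_homo (s t : R) : s < 1 -> t < 1 -> s <= t -> height s <= height t.
Proof.
move=> s1 t1 st; rewrite lerD2r ler_wpM2l// lef_pV2 ?posrE ?subr_gt0//.
by rewrite lerD2l lerN2.
Qed.

(** Since [height] has derivative [2 (1 - s)^(-2)], the function [F] below is an antiderivative of
    the integrand. Its term at [b] is nonpositive and is dropped. *)
Lemma integral_height_itv_le (d a b : R) : 0 < d -> a < b -> b < 1 ->
  0 < height a ->
  (\int[lebesgue_measure]_(s in `[a, b])
     ((1 - s) ^- 2 * height s `^ (- d - 1))%:E <=
   ((2 * d)^-1 * height a `^ (- d))%:E)%E.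
Proof.
move=> d0 ab b1 ha.
have gt0 s : a <= s <= b -> s < 1 /\ 0 < height s.
  move=> /andP[as_ sb]; have s1 : s < 1 by exact: le_lt_trans b1.
  split=> //; apply: (lt_le_trans ha); apply: height_homo => //.
  exact: lt_trans b1.
pose F s := - (2 * d)^-1 * height s `^ (- d).
have dF s : a <= s <= b ->
    is_derive s (1 : R) F ((1 - s) ^- 2 * height s `^ (- d - 1)).
  move=> /gt0[s1 hs]; have d1 := is_derive_height_powR (- d) s1 hs.
  rewrite /F; apply: is_derive_eq.
  by rewrite /GRing.scale/=; field; rewrite !gt_eqF ?subr_gt0.
have cF s : a <= s <= b -> F x @[x --> s] --> F s.
  move=> /dF d1; apply: differentiable_continuous.
  by apply/derivable1_diffP; case: d1.
rewrite (@continuous_FTC2 _ _ F)//.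
- rewrite -EFinB lee_fin /F.
  have : 0 <= (2 * d)^-1 * height b `^ (- d).
    by rewrite mulr_ge0// ?powR_ge0// invr_ge0 mulr_ge0// ltW.
  by lra.
- apply: continuous_in_subspaceT => s /set_mem; rewrite /= in_itv/= => /gt0[? ?].
  exact: continuous_height_density.
- split.
  + by move=> s; rewrite in_itv/= => /andP[as_ sb]; have [] := dF s _; rewrite ?ltW.
  + by apply: cvg_at_right_filter; apply: cF; rewrite lexx ltW.
  + by apply: cvg_at_left_filter; apply: cF; rewrite lexx ltW.
- move=> s; rewrite in_itv/= => /andP[as_ sb].
  by rewrite derive1E; apply: derive_val; apply: dF; rewrite !ltW.
Qed.

Lemma integral_height_le (d T : R) : 0 < d -> 0 < T -> 0 < c ->
  (\int[lebesgue_measure]_(s in [set s : R | (s < 1 /\ T <= height s)%R])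
     ((1 - s) ^- 2 * height s `^ (- d - 1))%:E <=
   ((2 * d)^-1 * T `^ (- d))%:E)%E.
Proof.
(* [a] solves [height a = T], so the domain is [[a, 1[]; it is exhausted by the compact intervals
   [F n]. *)
move=> d0 T0 c0; pose a := 1 - 2 / (c + T).
have cT : 0 < c + T by rewrite addr_gt0.
have ha : height a = T.
  by rewrite /height /a opprB addrCA subrr addr0; field; rewrite gt_eqF.
have a1 : a < 1 by rewrite /a ltrBlDr ltrDl divr_gt0.
(* The denominator starts at 2, since with 1 the first interval would reduce to the point [a]. *)
pose F n : set R := `[a, (1 - (1 - a) / n.+2%:R)]%classic.
have bn n : a < 1 - (1 - a) / n.+2%:R < 1.
  have n0 : 0 < n.+2%:R :> R by rewrite ltr0n.
  rewrite ltrBrDr -ltrBrDl ltr_pdivrMr// ltr_pMr ?subr_gt0// ltr1n/=.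
  by rewrite ltrBlDr ltrDl divr_gt0// subr_gt0.
pose f (s : R) := ((1 - s) ^- 2 * height s `^ (- d - 1))%:E.
have f0 s : (0 <= f s)%E.
  rewrite lee_fin mulr_ge0// ?powR_ge0// invr_ge0 sqr_ge0//.
have mf : measurable_fun setT f.
  apply/measurable_EFinP.
  have m1 : measurable_fun setT (fun s : R => 1 - s).
    exact: measurable_funB.
  apply: measurable_funM; first by apply: measurable_funV; exact: measurable_funX.
  apply: (measurableT_comp (measurable_powR _)).
  apply: measurable_funB => //; apply: measurable_funM => //.
  exact: measurable_funV.
apply: (@le_trans _ _ (\int[lebesgue_measure]_(s in \bigcup_i F i) f s)%E).
  apply: ge0_le_integral_subset => [s _|s _|s [s1 Ts]]; [exact: f0|exact: f0|split=> //].
  have as_ : a <= s.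
    rewrite leNgt; apply/negP => sa.
    suff : height s < height a by rewrite ha ltNge Ts.
    rewrite /height ltrD2r ltr_pM2l// ltf_pV2 ?posrE ?subr_gt0//.
    by rewrite ltrD2l ltrN2.
  pose k := Num.truncn ((1 - a) / (1 - s)).
  exists k => //; rewrite /F/= in_itv/= as_/=.
  rewrite lerBrDr -lerBrDl ler_pdivrMr ?ltr0n// mulrC -ler_pdivrMr ?subr_gt0//.
  apply: ltW; apply: (lt_le_trans (truncnS_gt _)).
  by rewrite ler_nat.
have ndF : nondecreasing_seq F.
  apply/nondecreasing_seqP => n; rewrite subsetEset => s /=; rewrite /F/= !in_itv/=.
  move=> /andP[-> /= /le_trans]; apply.
  rewrite lerD2l lerN2 ler_wpM2l ?subr_ge0 ?(ltW a1)//.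
  by rewrite lef_pV2 ?posrE ?ltr0n// ler_nat.
have mF i : measurable (F i) by exact: measurable_itv.
have mfF i : measurable_fun (F i) f by exact: measurable_funTS.
have f0F i s : F i s -> (0 <= f s)%E by move=> _; exact: f0.
have /cvg_lim <- // := @ge0_nondecreasing_set_cvg_integral _ (measurableTypeR R) R F f
  lebesgue_measure ndF mF mfF f0F.
apply: lime_le.
  apply: ereal_nondecreasing_is_cvgn.
  exact: (@ge0_nondecreasing_set_nondecreasing_integral _ (measurableTypeR R)).
near=> n; have /andP[an n1] := bn n.
by rewrite -ha; apply: integral_height_itv_le => //; rewrite ha.
Unshelve. all: by end_near. Qed.

End VerticalIntegral.

(** * The contribution of one Voronoi cell *)

Section CellDensity.
Context {R : realType} {m : nat}.
Variables (rho : euclid R m.+1 -> R) (b : euclid R m.+1).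

Local Notation E := (euclid R m.+1).

Definition recentre (y : euclid R m.+2) : E :=
  [tuple tnth y (lift ord0 i) - (1 - thead y) * tnth b i | i < m.+1].

(* The density of the hyperbolic volume, cut off to the points y whose vertical
   projection p lies in the Voronoi cell of b, with gauge rho, and which satisfy
   z - |p|^2 >= |p - b|^2 / rho (p - b); recentre y is (1 - s) (p - b).  The
   exceptional fibre p = b is kept in, being negligible. *)
Definition cell_density (y : euclid R m.+2) : R :=
  let v := recentre y in
  if [&& thead y < 1, dotp y y < 1 & (dotp v v == 0) ||
      [&& 0 < rho v, rho v <= 1 - thead y &
          dotp v v * (1 - thead y) <= rho v * (1 - dotp y y)]]
  then (1 - dotp y y) `^ (- (m.+3%:R / 2)) else 0.

Lemma cell_density_ge0 y : 0 <= cell_density y.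
Proof. by rewrite /cell_density; case: ifPn => // _; exact: powR_ge0. Qed.

Hypothesis mrho : measurable_fun setT rho.
Hypothesis rhoZ : forall a w, 0 < a -> rho (homothety a origin w) = a * rho w.

Lemma measurable_thead n : measurable_fun setT (fun y : euclid R n.+1 => thead y : R).
Proof. exact: measurable_tnth. Qed.

Lemma measurable_recentre : measurable_fun setT recentre.
Proof.
apply/measurable_fun_tnthP => i.
rewrite (_ : _ \o _ = fun y : euclid R m.+2 =>
    (tnth y (lift ord0 i) : R) - (1 - thead y) * tnth b i); last first.
  by apply/funext => y; rewrite /= tnth_mktuple.
have mt := @measurable_thead m.+1.
apply: measurable_funB; first exact: measurable_tnth.
by apply: measurable_funM => //; exact: measurable_funB.
Qed.

Lemma measurable_cell_density : measurable_fun setT cell_density.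
Proof.
have mt := @measurable_thead m.+1; have mv := measurable_recentre.
have mt1 : measurable_fun setT (fun y : euclid R m.+2 => 1 - thead y : R).
  exact: measurable_funB.
have my : measurable_fun setT (fun y : euclid R m.+2 => dotp y y).
  exact: measurable_dotp.
have my1 : measurable_fun setT (fun y : euclid R m.+2 => 1 - dotp y y).
  exact: measurable_funB.
have mvv : measurable_fun setT (fun y => dotp (recentre y) (recentre y)).
  exact: measurable_dotp.
have mr : measurable_fun setT (fun y => rho (recentre y)).
  exact: (measurableT_comp mrho mv).
apply: measurable_fun_ifT => //; last first.
  exact: (measurableT_comp (measurable_powR _)).
apply: measurable_and; first exact: measurable_fun_ltr.
apply: measurable_and; first exact: measurable_fun_ltr.
apply: measurable_or; first exact: measurable_fun_eqr.
apply: measurable_and; first exact: measurable_fun_ltr.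
apply: measurable_and; first exact: measurable_fun_ler.
by apply: measurable_fun_ler; exact: measurable_funM.
Qed.

(** The Klein point [(s, y')] whose vertical projection is [p = w + b], that is,
    [y' = (1 - s) (w + b)]. *)
Let lift_point (z : measurableTypeR R * E) : euclid R m.+2 :=
  tuple_of_pair (z.1, [tuple (1 - (z.1 : R)) * (tnth z.2 i + tnth b i) | i < m.+1]).

Let measurable_lift_point : measurable_fun setT lift_point.
Proof.
apply: measurable_tuple_of_pair_comp; first exact: measurable_fst.
apply/measurable_fun_tnthP => i.
rewrite (_ : _ \o _ = fun z : measurableTypeR R * E =>
   (1 - (z.1 : R)) * (tnth z.2 i + tnth b i)); last first.
  by apply/funext => z; rewrite /= tnth_mktuple.
have m1 : measurable_fun setT (fun z : measurableTypeR R * E => z.1 : R).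
  exact: measurable_fst.
apply: measurable_funM; first exact: measurable_funB.
apply: measurable_funD => //.
exact: (measurableT_comp (measurable_tnth i) measurable_snd).
Qed.

Let thead_lift_point (s : R) (w : E) : thead (lift_point (s, w)) = s.
Proof. by rewrite /lift_point /tuple_of_pair theadE. Qed.

Let recentre_lift_point (s : R) (w : E) :
  recentre (lift_point (s, w)) = homothety (1 - s) origin w.
Proof.
apply/eq_from_tnth => i; rewrite !tnth_mktuple thead_lift_point.
by rewrite /lift_point tnthS tnth_mktuple /=; ring.
Qed.

(** From [1 - s^2 = (1 - s)^2 (2 / (1 - s) - 1)]: the hyperbolic density becomes a power of [1 - s]
    times a power of the height. *)
Let dotp_lift_point (s : R) (w : E) : s < 1 ->
  1 - dotp (lift_point (s, w)) (lift_point (s, w)) =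
  (1 - s) ^+ 2 * height (1 + dotp (homothety 1 b w) (homothety 1 b w)) s.
Proof.
move=> s1; rewrite /dotp big_ord_recl tnth0 /=.
rewrite (eq_bigr (fun i => (1 - s) ^+ 2 *
    (tnth (homothety 1 b w) i * tnth (homothety 1 b w) i))) => [|i _].
  rewrite -mulr_sumr /height; set q := \sum_(i < _) _; field.
  by rewrite gt_eqF// subr_gt0.
by rewrite tnthS !tnth_mktuple /=; ring.
Qed.

(** The cell density in the coordinates [(s, w)]; the power of [1 - s] is the Jacobian of
    [lift_point]. *)
Let Psi (z : measurableTypeR R * E) : \bar R :=
  (if (z.1 : R) < 1 then (1 - (z.1 : R)) ^+ m.+1 * cell_density (lift_point z)
  else 0)%:E.

Let Psi_ge0 z : (0 <= Psi z)%E.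
Proof.
rewrite lee_fin; case: ifPn => // z1.
by rewrite mulr_ge0 ?cell_density_ge0// exprn_ge0// subr_ge0 ltW.
Qed.

Let measurable_Psi : measurable_fun setT Psi.
Proof.
have m1 : measurable_fun setT (fun z : measurableTypeR R * E => z.1 : R).
  exact: measurable_fst.
apply/measurable_EFinP; apply: measurable_fun_ifT => //.
  exact: measurable_fun_ltr.
apply: measurable_funM; first by apply: measurable_funX; exact: measurable_funB.
exact: (measurableT_comp measurable_cell_density measurable_lift_point).
Qed.

Let integral_cell_density_Psi :
  (\int[lebesgue_tuple m.+2]_y (cell_density y)%:E =
   \int[lebesgue_tuple m.+1]_w \int[lebesgue_measure]_s Psi (s, w))%E.
Proof.
have mE : measurable_fun setT (EFin \o cell_density).
  by apply/measurable_EFinP; exact: measurable_cell_density.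
have E0 y : (0 <= (EFin \o cell_density) y)%E by rewrite lee_fin cell_density_ge0.
rewrite (integral_lebesgue_tupleS mE E0) -(fubini_tonelli Psi)//.
apply: eq_integral => s _.
have [s1|s1] := ltP s 1; last first.
  have F0 w : cell_density (tuple_of_pair (s, w)) = 0.
    by rewrite /cell_density /tuple_of_pair theadE ltNge s1.
  by apply: eq_integral => w _; rewrite /Psi /= F0 ltNge s1.
have s10 : 0 < 1 - s by rewrite subr_gt0.
have ms : measurable_fun setT (fun w : E => (EFin \o cell_density) (tuple_of_pair (s, w))).
  by apply: (measurableT_comp mE); exact: measurable_tuple_of_pair_comp.
rewrite (integral_homothety (homothety (1 - s) origin b) s10 ms (fun w => E0 _)).
rewrite -ge0_integralZl_EFin//; last 2 first.
- by apply: (measurableT_comp ms); exact: measurable_homothety.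
- by rewrite exprn_ge0// ltW.
apply: eq_integral => w _; rewrite /Psi /= s1 -EFinM; congr (_ * cell_density _)%:E.
congr tuple_of_pair; congr pair; apply/eq_from_tnth => i.
by rewrite !tnth_mktuple /=; ring.
Qed.

(** The Jacobian and the density contribute [(1 - s)^(m+1)] and [(1 - s)^(-(m+3))], leaving
    [(1 - s)^(-2)]. By homogeneity of [rho] the cut-offs become [rho w <= 1] and a lower bound on
    the height. *)
Let Psi_le (s : R) (w : E) : 0 < dotp w w ->
  (Psi (s, w) <= (if [&& s < 1, 0 < rho w, rho w <= 1 &
      dotp w w / rho w <= height (1 + dotp (homothety 1 b w) (homothety 1 b w)) s]
    then (1 - s) ^- 2 *
      height (1 + dotp (homothety 1 b w) (homothety 1 b w)) s `^ (- (m.+1%:R / 2) - 1)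
    else 0)%:E)%E.
Proof.
move=> w0; rewrite lee_fin /=; set c := 1 + dotp _ _.
case: (ltP s 1) => //= s1; have s10 : 0 < 1 - s by rewrite subr_gt0.
rewrite /cell_density thead_lift_point recentre_lift_point rhoZ// s1/=.
rewrite dotp_scale mulf_eq0 sqrf_eq0 gt_eqF//= (gt_eqF w0)/=.
case: ifPn; last first.
  rewrite mulr0; case: ifPn => // _ _.
  by rewrite mulr_ge0 ?powR_ge0// invr_ge0 sqr_ge0.
rewrite -[dotp (lift_point _) _ < 1]subr_gt0 dotp_lift_point// -/c.
rewrite pmulr_rgt0 ?exprn_gt0// pmulr_rgt0//.
move=> /and4P[h0 r0 r1' hw].
have r1 : rho w <= 1 by rewrite -(ler_pM2l s10) mulr1.
rewrite r0 r1 /=.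
have -> : dotp w w / rho w <= height c s.
  rewrite ler_pdivrMr// -(ler_pM2l (exprn_gt0 3 s10)).
  by move: hw; congr (_ <= _); ring.
rewrite powRM ?sqr_ge0 ?(ltW h0)//.
have -> : - (m.+3%:R / 2) = - (m.+1%:R / 2) - 1 :> R.
  by rewrite -[m.+3]addn2 natrD; field.
rewrite mulrA ler_wpM2r ?powR_ge0//.
have -> : - (m.+1%:R / 2) - 1 = - (m.+3%:R / 2) :> R.
  by rewrite -[m.+3]addn2 natrD; field.
have -> : ((1 - s) ^+ 2) `^ (- (m.+3%:R / 2)) = (1 - s) ^- m.+3.
  rewrite powRN -[_ ^+ 2]powR_mulrn ?(ltW s10)// -powRrM mulrC divfK ?pnatr_eq0//.
  by rewrite powR_mulrn// ltW.
rewrite -[m.+3]addn2 exprD invfM mulrA.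
by rewrite divff ?mul1r// expf_neq0// gt_eqF.
Qed.

Let lebesgue_tuple_origin :
  lebesgue_tuple m.+1 [set w : euclid R m.+1 | dotp w w = 0] = 0%E.
Proof.
have -> : [set w : E | dotp w w = 0] = [set w | forall i, [set 0] (tnth w i)].
  apply/seteqP; split => w /= w0.
    by move=> i; rewrite (dotp_eq0 w0) tnth_origin.
  by rewrite /dotp big1// => i _; rewrite w0 mulr0.
rewrite (@lebesgue_tuple_box _ _ (fun=> [set 0])) => [|i]; last exact: measurable_set1.
by rewrite big_ord_recl lebesgue_measure_set1 mul0e.
Qed.

(** Off the null fibre [w = 0], integrating vertically bounds the inner integral by
    [cone_density w], to which the bound uniform in [rho] applies. *)
Lemma integral_cell_density_le :
  (\int[lebesgue_tuple m.+2]_y (cell_density y)%:E <= (2 * 8 ^+ m.+1)%:E)%E.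
Proof.
rewrite integral_cell_density_Psi.
have mF : measurable_fun setT (fun w : E => \int[lebesgue_measure]_s Psi (s, w))%E.
  exact: measurable_fun_fubini_tonelli_G.
have m0 : measurable [set w : E | dotp w w = 0].
  rewrite [X in measurable X](_ : _ =
      setT `&` (fun x : E => dotp x x) @^-1` [set 0]).
    by apply: measurable_dotp => //; exact: measurable_set1.
  by apply/seteqP; split => x /=; [split|case].
rewrite (ge0_negligible_integral m0 measurableT mF); last 2 first.
- by move=> w _; apply: integral_ge0 => s _; exact: Psi_ge0.
- exact: lebesgue_tuple_origin.
apply: le_trans (cone_integral_le mrho rhoZ).
apply: ge0_le_integral_subset => w.
- by move=> _; apply: integral_ge0 => s _; exact: Psi_ge0.
- by move=> _; rewrite lee_fin cone_density_ge0.
move=> [_ /= /eqP w0]; split => //.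
have {}w0 : 0 < dotp w w by rewrite lt_def w0 dotp_ge0.
have nw0 : 0 < norm2 w by rewrite sqrtr_gt0.
rewrite /cone_density nw0 /=.
have [/andP[r0 r1]|rN] := boolP ((0 < rho w) && (rho w <= 1)); last first.
  rewrite integral0_eq// => s _; apply/eqP; rewrite eq_le Psi_ge0 andbT.
  apply: (le_trans (Psi_le s w0)); case: ifPn => // /and4P[_ a c _].
  by rewrite a c in rN.
set c := 1 + dotp (homothety 1 b w) (homothety 1 b w).
have c0 : 0 < c by rewrite ltr_pwDl// dotp_ge0.
(* The vertical integral is taken with [d = (m+1)/2] and [T = |w|^2 / rho w], which is [r tau]; its
   prefactor [1 / (2 d) = 1 / (m+1)] is at most 1. *)
have d0 : 0 < m.+1%:R / 2 :> R by rewrite divr_gt0.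
have T0 : 0 < dotp w w / rho w by rewrite divr_gt0.
apply: (@le_trans _ _ ((2 * (m.+1%:R / 2))^-1 * (dotp w w / rho w) `^ (- (m.+1%:R / 2)))%:E).
  apply: le_trans (integral_height_le d0 T0 c0).
  rewrite [leRHS]integral_mkcond; apply: ge0_le_integral_subset => s _.
  - exact: Psi_ge0.
  - apply: erestrict_ge0 => t _.
    by rewrite lee_fin mulr_ge0 ?powR_ge0// invr_ge0 sqr_ge0.
  - split=> //; apply: (le_trans (Psi_le s w0)); rewrite patchE -/c.
    case: ifPn => [/and4P[s1 _ _ sT]|_]; first by rewrite mem_set.
    case: ifPn => // _.
    by rewrite lee_fin mulr_ge0 ?powR_ge0// invr_ge0 sqr_ge0.
rewrite lee_fin.
have -> : (dotp w w / rho w) `^ (- (m.+1%:R / 2)) = (Num.sqrt (rho w) / norm2 w) ^+ m.+1.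
  rewrite powRN -mulrC mulrC (mulrC _ 2^-1) powRrM powR12_sqrt ?(ltW T0)//.
  rewrite powR_mulrn ?sqrtr_ge0// -exprVn; congr (_ ^+ _).
  by rewrite sqrtrM ?dotp_ge0// sqrtrV ?(ltW r0)// invfM invrK mulrC.
rewrite ler_piMl ?exprn_ge0 ?divr_ge0 ?sqrtr_ge0//.
rewrite mulrCA divff// mulr1 invf_le1// ?ler1n// ltr0n//.
Qed.

End CellDensity.

(** * Geodesics of the Klein model *)

Section Geodesics.
Context {R : realType} {n : nat}.
Implicit Types (x y g : hyperbolic R n) (u v w : euclid R n).

Definition lincomb (a : R) u (b : R) v : euclid R n :=
  [tuple a * tnth u i + b * tnth v i | i < n].

Lemma dotpC u v : dotp u v = dotp v u.
Proof. by apply: eq_bigr => i _; rewrite mulrC. Qed.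

Lemma dotp_lincombl a u b v w :
  dotp (lincomb a u b v) w = a * dotp u w + b * dotp v w.
Proof.
rewrite /dotp !mulr_sumr -big_split; apply: eq_bigr => i _ /=.
by rewrite tnth_mktuple; ring.
Qed.

Lemma dotp_lincombr a u b v w :
  dotp w (lincomb a u b v) = a * dotp w u + b * dotp w v.
Proof. by rewrite dotpC dotp_lincombl ![dotp _ w]dotpC. Qed.

Lemma dotp_klein_lt1 x y : dotp (klein x) (klein y) < 1.
Proof.
have := dotp_ge0 (lincomb 1 (klein x) (-1) (klein y)).
rewrite dotp_lincombl !dotp_lincombr [dotp (klein y) (klein x)]dotpC.
have := klein_ball x; have := klein_ball y; lra.
Qed.

(** Cauchy-Schwarz is reversed for the timelike vectors [(1, x)] and [(1, y)]: the defect is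
    [|x - y|^2 (1 - |x|^2) + <x, y - x>^2]. It puts the argument of [arcosh] in [hdist] above 1. *)
Lemma reverse_Cauchy_Schwarz x y :
  (1 - dotp (klein x) (klein x)) * (1 - dotp (klein y) (klein y)) <=
  (1 - dotp (klein x) (klein y)) ^+ 2.
Proof.
have := dotp_ge0 (lincomb 1 (klein x) (-1) (klein y)).
rewrite dotp_lincombl !dotp_lincombr [dotp (klein y) (klein x)]dotpC.
move: (klein_ball x) => x1; set a := dotp (klein x) (klein x) in x1 *.
set b := dotp (klein y) (klein y); set c := dotp (klein x) (klein y) => e0.
rewrite -subr_ge0.
have -> : (1 - c) ^+ 2 - (1 - a) * (1 - b) =
  (1 * (1 * a + -1 * c) + -1 * (1 * c + -1 * b)) * (1 - a) + (c - a) ^+ 2 by ring.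
by rewrite addr_ge0 ?sqr_ge0// mulr_ge0// subr_ge0 ltW.
Qed.

(** With [s^2 = u^2 - 1], [u + s] and [u - s] are inverse to each other. Writing cosh through the
    exponential makes the later identities rational. *)
Lemma expR_arcosh (u : R) : 1 <= u ->
  1 <= expR (arcosh u) /\ u = (expR (arcosh u) + (expR (arcosh u))^-1) / 2.
Proof.
move=> u1; have u21 : 0 <= u ^+ 2 - 1 by rewrite subr_ge0 expr_ge1// (le_trans _ u1).
set s := Num.sqrt (u ^+ 2 - 1).
have s0 : 0 <= s by exact: sqrtr_ge0.
have s2 : s ^+ 2 = u ^+ 2 - 1 by rewrite sqr_sqrtr.
have e0 : 0 < u + s by lra.
rewrite /arcosh -/s lnK ?posrE//; split; first by lra.
have -> : (u + s)^-1 = u - s.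
  apply: (mulfI (lt0r_neq0 e0)); rewrite divff ?lt0r_neq0//.
  by rewrite mulrC -subr_sqr s2; ring.
by field.
Qed.

(** Lorentz norm of [(1, klein x)]; dividing by it gives the point of the hyperboloid. *)
Definition weight x := Num.sqrt (1 - dotp (klein x) (klein x)).

Lemma weight_gt0 x : 0 < weight x.
Proof. by rewrite sqrtr_gt0 subr_gt0 klein_ball. Qed.

Lemma sqr_weight x : weight x ^+ 2 = 1 - dotp (klein x) (klein x).
Proof. by rewrite sqr_sqrtr// subr_ge0 ltW// klein_ball. Qed.

Lemma expR_hdist x y : 1 <= expR (hdist x y) /\
  1 - dotp (klein x) (klein y) =
  weight x * weight y * ((expR (hdist x y) + (expR (hdist x y))^-1) / 2).
Proof.
have wx := weight_gt0 x; have wy := weight_gt0 y.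
have w0 : 0 < weight x * weight y by rewrite mulr_gt0.
set u := (1 - dotp (klein x) (klein y)) / (weight x * weight y).
have hE : hdist x y = arcosh u.
  by rewrite /hdist sqrtrM// subr_ge0 ltW// klein_ball.
have u1 : 1 <= u.
  rewrite ler_pdivlMr// mul1r -(@ler_sqr R) ?nnegrE ?(ltW w0)//; last first.
    by rewrite subr_ge0 ltW// dotp_klein_lt1.
  by rewrite exprMn !sqr_weight reverse_Cauchy_Schwarz.
have [e1 uE] := expR_arcosh u1; rewrite hE; split=> //.
by rewrite -uE /u mulrC divfK// gt_eqF.
Qed.

(** The Lorentz complement of the timelike vector [(1, g)] is spacelike, so it contains no nonzero
    null vector: here [|w - w0 g|^2 = - w0^2 (1 - |g|^2)]. *)
Lemma lorentz_null_orthogonal g (w0 : R) w :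
  w0 = dotp w (klein g) -> w0 ^+ 2 = dotp w w -> w0 = 0 /\ w = origin.
Proof.
move=> w0E w02.
have := dotp_ge0 (lincomb 1 w (- w0) (klein g)).
rewrite dotp_lincombl !dotp_lincombr [dotp (klein g) w]dotpC -w0E -w02.
have := klein_ball g; set a := dotp (klein g) (klein g) => a1 e0.
have {}w0E : w0 = 0.
  have : 0 <= - (w0 ^+ 2 * (1 - a)) by move: e0; congr (_ <= _); ring.
  rewrite oppr_ge0 pmulr_lle0 ?subr_gt0// => w00.
  by apply/eqP; rewrite -sqrf_eq0 eq_le w00 sqr_ge0.
by split=> //; apply: dotp_eq0; rewrite -w02 w0E expr0n.
Qed.

(* The null vector orthogonal to g is, on the hyperboloid,
   sinh(b) X + sinh(a) Y - sinh(a + b) G with p = exp(a) and q = exp(b). *)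
Lemma lorentz_collinear x g y (p q rx ry rg : R) :
  1 <= p -> 1 <= q -> 1 < p * q -> 0 < rx -> 0 < ry -> 0 < rg ->
  rx ^+ 2 = 1 - dotp (klein x) (klein x) ->
  ry ^+ 2 = 1 - dotp (klein y) (klein y) ->
  rg ^+ 2 = 1 - dotp (klein g) (klein g) ->
  1 - dotp (klein x) (klein g) = rx * rg * ((p + p^-1) / 2) ->
  1 - dotp (klein g) (klein y) = rg * ry * ((q + q^-1) / 2) ->
  1 - dotp (klein x) (klein y) = rx * ry * ((p * q + (p * q)^-1) / 2) ->
  exists2 l : R, 0 <= l <= 1 & klein g = lincomb (1 - l) (klein x) l (klein y).
Proof.
move=> p1 q1 pq1 wx wy wg x2 y2 g2 cxg cgy cxy.
have p0 : p != 0 by rewrite gt_eqF// (lt_le_trans ltr01).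
have q0 : q != 0 by rewrite gt_eqF// (lt_le_trans ltr01).
have wx0 : rx != 0 by rewrite gt_eqF.
have wy0 : ry != 0 by rewrite gt_eqF.
have wg0 : rg != 0 by rewrite gt_eqF.
(* These are sinh(a), sinh(b) and sinh(a + b); dividing by the weights below expresses the
   combination in the vectors [(1, klein _)]. *)
pose sa := (p - p^-1) / 2; pose sb := (q - q^-1) / 2.
pose sab := (p * q - (p * q)^-1) / 2.
pose al := sb / rx; pose be := sa / ry; pose ga := sab / rg.
pose w := lincomb 1 (lincomb al (klein x) be (klein y)) (- ga) (klein g).
have w0E : al + be - ga = dotp w (klein g).
  apply/eqP; rewrite -subr_eq0 !dotp_lincombl; apply/eqP.
  transitivity (al * (1 - dotp (klein x) (klein g)) +
    be * (1 - dotp (klein g) (klein y)) - ga * (1 - dotp (klein g) (klein g))).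
    by rewrite [dotp (klein y) _]dotpC; ring.
  rewrite cxg cgy -g2 /al /be /ga /sa /sb /sab; field.
  by rewrite wx0 wy0 wg0 p0 q0.
have w02 : (al + be - ga) ^+ 2 = dotp w w.
  apply/eqP; rewrite -subr_eq0 !(dotp_lincombl, dotp_lincombr); apply/eqP.
  transitivity (al ^+ 2 * (1 - dotp (klein x) (klein x)) +
     be ^+ 2 * (1 - dotp (klein y) (klein y)) +
     ga ^+ 2 * (1 - dotp (klein g) (klein g)) +
     2 * al * be * (1 - dotp (klein x) (klein y)) -
     2 * al * ga * (1 - dotp (klein x) (klein g)) -
     2 * be * ga * (1 - dotp (klein g) (klein y))).
    rewrite [dotp (klein y) (klein x)]dotpC [dotp (klein g) (klein x)]dotpC.
    by rewrite [dotp (klein y) (klein g)]dotpC; ring.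
  rewrite cxg cgy cxy -g2 -x2 -y2 /al /be /ga /sa /sb /sab; field.
  by rewrite wx0 wy0 wg0 p0 q0.
have [s0 wo] := lorentz_null_orthogonal w0E w02.
have gaE : ga = al + be by apply/eqP; rewrite eq_sym -subr_eq0 s0.
have sa0 : 0 <= sa.
  by rewrite divr_ge0// subr_ge0 (@le_trans _ _ 1)// invf_le1// (lt_le_trans ltr01).
have sb0 : 0 <= sb.
  by rewrite divr_ge0// subr_ge0 (@le_trans _ _ 1)// invf_le1// (lt_le_trans ltr01).
have ga0 : 0 < ga.
  rewrite divr_gt0// divr_gt0// subr_gt0 (lt_trans _ pq1)// invf_lt1//.
  exact: lt_trans pq1.
have be0 : 0 <= be by rewrite divr_ge0// ltW.
have al0 : 0 <= al by rewrite divr_ge0// ltW.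
clear -gaE ga0 be0 al0 wo.
(* The time coordinate gives [ga = al + be], the space coordinates give [ga g = al x + be y];
   dividing by [ga] exhibits a convex combination. *)
exists (be / ga).
  by rewrite divr_ge0 ?(ltW ga0)//= ler_pdivrMr// mul1r gaE lerDr.
apply/eq_from_tnth => i; rewrite tnth_mktuple.
have := congr1 (fun z => tnth z i) wo; rewrite tnth_origin /w !tnth_mktuple => wi.
apply: (mulfI (lt0r_neq0 ga0)).
transitivity ((ga - be) * tnth (klein x) i + be * tnth (klein y) i); last first.
  by field; rewrite gt_eqF.
by apply/eqP; rewrite -subr_eq0 -oppr_eq0 -wi gaE; apply/eqP; ring.
Qed.

(** Equality in the triangle inequality forces [g] onto the chord: additivity of distances says that
    their exponentials multiply, as [lorentz_collinear] requires. *)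
Lemma hdist_add_segment x g y (t : R) : 0 < hdist x y ->
  hdist x g = t -> hdist g y = hdist x y - t ->
  exists2 l : R, 0 <= l <= 1 & klein g = lincomb (1 - l) (klein x) l (klein y).
Proof.
move=> D0 xg gy.
have [p1 cxg] := expR_hdist x g; have [q1 cgy] := expR_hdist g y.
have [_ cxy] := expR_hdist x y.
have pq1 : 1 < expR (hdist x y) by rewrite expR_gt1.
have DE : expR (hdist x y) = expR (hdist x g) * expR (hdist g y).
  by rewrite -expRD xg gy subrKC.
rewrite DE in cxy pq1.
exact: (lorentz_collinear p1 q1 pq1 (weight_gt0 x) (weight_gt0 y) (weight_gt0 g)
  (sqr_weight x) (sqr_weight y) (sqr_weight g) cxg cgy cxy).
Qed.

End Geodesics.

(** * The hyperbolic hull lies in the Euclidean hull *)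

Section Hull.
Context {R : realType} {n N : nat}.
Variable x : 'I_N -> hyperbolic R n.

Definition klein_hull : set (euclid R n) :=
  [set y | exists l : 'I_N -> R, [/\ forall k, 0 <= l k, \sum_k l k = 1 &
     forall i, tnth y i = \sum_k l k * tnth (klein (x k)) i]].

(** The points of Euclidean hull form a geodesically convex set containing the [x k], because
    geodesics run along chords. *)
Lemma klein_hconv_subset h : hconv (range x) h -> klein_hull (klein h).
Proof.
move: h; apply: smallest_sub.
  move=> y z gam [ly [ly0 ly1 lyE]] [lz [lz0 lz1 lzE]] [g0 gD iso] t tD.
  move: (tD); rewrite in_itv/= => /andP[t0 tleD].
  (* For a nonpositive distance the parameter interval contains at most [t = 0]. *)
  have [D0|D0] := ltP 0 (hdist y z); last first.
    have -> : t = 0 by apply/eqP; rewrite eq_le t0 (le_trans tleD).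
    by rewrite g0; exists ly.
  have i0 : 0 \in `[0, hdist y z] by rewrite in_itv/= lexx ltW.
  have iD : hdist y z \in `[0, hdist y z] by rewrite in_itv/= lexx ltW.
  have yg : hdist y (gam t) = t by rewrite -[y in LHS]g0 iso// sub0r normrN ger0_norm.
  have gz : hdist (gam t) z = hdist y z - t.
    by rewrite -[z in LHS]gD iso// distrC ger0_norm// subr_ge0.
  have [a /andP[a0 a1] gE] := hdist_add_segment D0 yg gz.
  exists (fun k => (1 - a) * ly k + a * lz k); split.
  - by move=> k; rewrite addr_ge0// mulr_ge0// subr_ge0.
  - by rewrite big_split/= -!mulr_sumr ly1 lz1 !mulr1 subrK.
  - move=> i; rewrite gE tnth_mktuple lyE lzE !mulr_sumr -big_split.
    by apply: eq_bigr => k _ /=; ring.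
move=> _ [k _ <-]; exists (fun j => (j == k)%:R); split.
- by move=> j; rewrite ler0n.
- by rewrite (bigD1 k)//= eqxx big1 ?addr0// => j /negbTE ->.
- move=> i; rewrite (bigD1 k)//= eqxx mul1r big1 ?addr0// => j /negbTE ->.
  by rewrite mul0r.
Qed.

End Hull.

(** * Covering the hull by Voronoi cells *)

Section Covering.
Context {R : realType} {m N : nat}.
Implicit Types (y : euclid R m.+2) (p v w : euclid R m.+1).

Definition tail_point y : euclid R m.+1 := [tuple tnth y (lift ord0 i) | i < m.+1].

Lemma dotp_tail y : dotp y y = thead y ^+ 2 + dotp (tail_point y) (tail_point y).
Proof.
rewrite /dotp big_ord_recl -expr2; congr (_ + _).
by apply: eq_bigr => i _; rewrite tnth_mktuple.
Qed.

Lemma recentreE b y :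
  recentre b y = lincomb 1 (tail_point y) (- (1 - thead y)) b.
Proof. by apply/eq_from_tnth => i; rewrite !tnth_mktuple; ring. Qed.

(** The vertical projection [p = y' / (1 - s)] of the overview. *)
Definition boundary_chart y : euclid R m.+1 :=
  homothety (1 - thead y)^-1 origin (tail_point y).

Lemma tail_pointE y : thead y < 1 ->
  tail_point y = homothety (1 - thead y) origin (boundary_chart y).
Proof.
move=> y1; apply/eq_from_tnth => i; rewrite !tnth_mktuple !addr0.
by rewrite mulrA divff ?mul1r// gt_eqF// subr_gt0.
Qed.

Lemma dotp_sum (I : finType) n (c : I -> R) (u : I -> euclid R n) (v w : euclid R n) :
  (forall i, tnth v i = \sum_k c k * tnth (u k) i) ->
  dotp v w = \sum_k c k * dotp (u k) w.
Proof.
move=> vE; rewrite /dotp; under eq_bigr => i _ do rewrite vE mulr_suml.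
rewrite exchange_big; apply: eq_bigr => k _; rewrite mulr_sumr.
by apply: eq_bigr => i _; rewrite mulrA.
Qed.

Lemma thead_lt1 y : dotp y y < 1 -> thead y < 1.
Proof.
move=> y1; have : thead y ^+ 2 < 1 by exact: le_lt_trans (sqr_tnth_le_dotp y ord0) y1.
by nra.
Qed.

Variable p : 'I_N -> euclid R m.+1.

Definition diff_point k l : euclid R m.+1 := lincomb 1 (p l) (-1) (p k).

(* The gauge of the Voronoi cell of p k, with p k moved to the origin. *)
Definition voronoi_gauge k w : R := \big[Num.max/0]_(l < N)
  (2 * dotp (diff_point k l) w / dotp (diff_point k l) (diff_point k l)).

Lemma measurable_voronoi_gauge k : measurable_fun setT (voronoi_gauge k).
Proof.
rewrite /voronoi_gauge; elim: (index_enum _) => [|l s IHs].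
  by under eq_fun do rewrite big_nil; exact: measurable_cst.
under eq_fun do rewrite big_cons.
apply: measurable_maxr => //.
by apply: measurable_funM => //; apply: measurable_funM => //; exact: measurable_dotp.
Qed.

Lemma voronoi_gaugeZ k (a : R) w : 0 < a ->
  voronoi_gauge k (homothety a origin w) = a * voronoi_gauge k w.
Proof.
move=> a0; rewrite /voronoi_gauge (big_morph _ (fun c d : R => maxr_pMr c d (ltW a0)) (mulr0 a)).
apply: eq_bigr => l _; rewrite [RHS]mulrA; congr (_ / _).
rewrite mulrCA; congr (2 * _); rewrite /dotp mulr_sumr.
by apply: eq_bigr => i _; rewrite !tnth_mktuple; ring.
Qed.

(** This is [<p_l - p_k, theta> <= |p_l - p_k|^2 / (2 tau)] from the overview, multiplied by
    [2 r]. *)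
Lemma dotp_diff_le_gauge k l w : 2 * dotp (diff_point k l) w <=
  voronoi_gauge k w * dotp (diff_point k l) (diff_point k l).
Proof.
(* When [p l = p k], in particular for [l = k], the quotient in the gauge is 0 by convention, but
   both sides of the claim vanish. *)
have [d0|d0] := eqVneq (dotp (diff_point k l) (diff_point k l)) 0.
  rewrite d0 mulr0 (dotp_eq0 d0) /dotp big1 ?mulr0// => i _.
  by rewrite tnth_origin mul0r.
by rewrite -ler_pdivrMr ?lt_def ?d0 ?dotp_ge0//; exact: le_bigmax.
Qed.

Lemma voronoi_gauge_le k w (r : R) : 0 <= r ->
  (forall l, 2 * dotp (diff_point k l) w <= r * dotp (diff_point k l) (diff_point k l)) ->
  voronoi_gauge k w <= r.
Proof.
move=> r0 wr; apply: bigmax_le => // l _.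
have [d0|d0] := eqVneq (dotp (diff_point k l) (diff_point k l)) 0.
  by rewrite d0 invr0 mulr0.
by rewrite ler_pdivrMr ?wr// lt_def d0 dotp_ge0.
Qed.

End Covering.

(** * Height estimate over each cell and summation *)

Section HullCovering.
Context {R : realType} {m N : nat}.
Variable x : 'I_N -> hyperbolic R m.+2.

Local Notation p := (fun k => boundary_chart (klein (x k))).

(** The index [k] is that of the [p k] nearest to the vertical projection of [y]. The averaging
    argument of the overview, multiplied through by powers of [u = 1 - s], yields the cut-offs of
    [cell_density]. *)
Lemma exists_cell_density y : dotp y y < 1 -> klein_hull x y ->
  exists k, cell_density (voronoi_gauge p k) (p k) y =
    (1 - dotp y y) `^ (- (m.+3%:R / 2)).
Proof.
move=> y1 [l [l0 l1 yE]].
have s1 := thead_lt1 y1; pose u := 1 - thead y.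
have u0 : 0 < u by rewrite subr_gt0.
have [k0] : exists k0 : 'I_N, true.
  case: (pickP 'I_N) => [k _|N0]; first by exists k.
  by move: l1; rewrite big_pred0// => /eqP; rewrite eq_sym oner_eq0.
move=> _; pose F k := dotp (recentre (p k) y) (recentre (p k) y).
pose k := [arg min_(k < k0 | true) F k]%O.
have kmin j : F k <= F j by rewrite /k; case: arg_minP => // i _ /(_ j); exact.
exists k; set v := recentre (p k) y; rewrite /cell_density -/v s1 y1 /=.
(* Expanding [|v|^2 <= |v - u d|^2] and dividing by [u] gives [2 <d, v> <= u |d|^2]. *)
have v_cell : voronoi_gauge p k v <= u.
  apply: voronoi_gauge_le => [|j]; first exact: ltW.
  have := kmin j; rewrite /F -/v.
  have -> : recentre (p j) y = lincomb 1 v (- u) (diff_point p k j).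
    by apply/eq_from_tnth => i; rewrite !tnth_mktuple /u; ring.
  move: (diff_point p k j) => d.
  rewrite dotp_lincombl !dotp_lincombr [dotp v d]dotpC => vj.
  rewrite -(ler_pM2l u0); lra.
case: ifPn => // /negP; case.
have [//|v0 /=] := eqVneq (dotp v v) 0.
have {}v0 : 0 < dotp v v by rewrite lt_def v0 dotp_ge0.
(* The chart is projective, so the Klein weights [l j] are multiplied by [1 - s_j]; they now sum to
   [u], and [mu j / u] are the weights of the overview. *)
pose mu j := l j * (1 - thead (klein (x j))).
have xj1 j : thead (klein (x j)) < 1 by exact/thead_lt1/klein_ball.
have mu0 j : 0 <= mu j by rewrite mulr_ge0// subr_ge0 ltW.
have sE : thead y = \sum_j l j * thead (klein (x j)) by rewrite /thead yE.
have mu_sum : \sum_j mu j = u.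
  rewrite /u sE -l1 -sumrB; apply: eq_bigr => j _; rewrite /mu; ring.
have tE i : tnth (tail_point y) i = \sum_j mu j * tnth (p j) i.
  rewrite tnth_mktuple yE; apply: eq_bigr => j _.
  rewrite /mu /boundary_chart !tnth_mktuple addr0; field.
  by rewrite gt_eqF// subr_gt0.
have vE i : tnth v i = \sum_j mu j * tnth (diff_point p k j) i.
  rewrite /v recentreE tnth_mktuple tE -/u -mu_sum mulr_sumr mulNr mulr_suml -sumrB.
  by apply: eq_bigr => j _; rewrite [in RHS]tnth_mktuple; ring.
pose S := \sum_j mu j * dotp (diff_point p k j) (diff_point p k j).
have S0 : 0 <= S by apply: sumr_ge0 => j _; rewrite mulr_ge0// dotp_ge0.
have vS : 2 * dotp v v <= voronoi_gauge p k v * S.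
  rewrite {1}(dotp_sum _ vE) !mulr_sumr; apply: ler_sum => j _.
  rewrite mulrCA [leRHS]mulrCA ler_wpM2l//; exact: dotp_diff_le_gauge.
(* Otherwise [vS] would give [|v|^2 <= 0]: the hull has no point off the fibre [v = 0] in directions
   where the cell is unbounded. *)
have r0 : 0 < voronoi_gauge p k v.
  rewrite ltNge; apply/negP => r0; have := mulr_le0_ge0 r0 S0; lra.
pose T := \sum_j mu j * dotp (p j) (p j).
(* Each summand is [z_j >= |p_j|^2] in the form [(1 - s_j) |p_j|^2 <= 1 + s_j], which is the ball
   condition on [x j]. *)
have T_le : T <= 1 + thead y.
  rewrite sE -l1 -big_split; apply: ler_sum => j _ /=.
  have := klein_ball (x j); rewrite dotp_tail tail_pointE// dotp_scale.
  have : 0 < 1 - thead (klein (x j)) by rewrite subr_gt0.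
  set a := thead _; set q := dotp _ _ => a0 aq.
  have : (1 - a) * q <= 1 + a by rewrite -(ler_pM2l a0); nra.
  by move=> /(ler_wpM2l (l0 j)); rewrite /mu -/a; lra.
(* Both sides are [u^2] times the variance of the [p j] under the weights [mu j / u], which is
   invariant under translation by [p k]. *)
have uS : u * S - dotp v v = u * T - dotp (tail_point y) (tail_point y).
  have SE : S = T - 2 * dotp (tail_point y) (p k) + u * dotp (p k) (p k).
    rewrite (dotp_sum _ tE) mulr_sumr -sumrB -mu_sum mulr_suml -big_split.
    apply: eq_bigr => j _ /=; rewrite /diff_point dotp_lincombl !dotp_lincombr.
    by rewrite [dotp (p k) (p j)]dotpC; ring.
  rewrite SE /v recentreE dotp_lincombl !dotp_lincombr -/u.
  by rewrite [dotp (p k) (tail_point y)]dotpC; ring.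
rewrite r0 v_cell /=.
have yu : 1 - dotp y y = u * (1 + thead y) - dotp (tail_point y) (tail_point y).
  by rewrite dotp_tail /u; ring.
have uT : u * T <= u * (1 + thead y) by rewrite ler_wpM2l// ltW.
(* [h1] and [h2] together express [z - |p|^2 >= 2 r tau - r^2], and [h3] is [r <= tau], which lowers
   the bound to [r tau]. *)
have h1 : u * (2 * dotp v v) <= u * (voronoi_gauge p k v * S) by rewrite ler_wpM2l// ltW.
have h2 : voronoi_gauge p k v * (u * S) <=
    voronoi_gauge p k v * (1 - dotp y y + dotp v v).
  by rewrite ler_wpM2l ?(ltW r0)// yu; lra.
have h3 : voronoi_gauge p k v * dotp v v <= u * dotp v v.
  by rewrite ler_wpM2r// ltW.
by rewrite -/u; lra.
Qed.

(** At each point of the hull one summand equals the hyperbolic density and the others are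
    nonnegative, so overlaps between cells do no harm. *)
Lemma hvol_hconv_le : (hvol (hconv (range x)) <= (2 * 8 ^+ m.+1 * N%:R)%:E)%E.
Proof.
pose D k y := (cell_density (voronoi_gauge p k) (p k) y)%:E.
have D0 k y : (0 <= D k y)%E by rewrite lee_fin cell_density_ge0.
apply: (@le_trans _ _ (\int[lebesgue_tuple m.+2]_y \sum_(k < N) D k y)%E).
  apply: ge0_le_integral_subset => y.
  - by move=> _; rewrite lee_fin powR_ge0.
  - by move=> _; exact: sume_ge0.
  move=> [h hX <-]; split=> //.
  have [k <-] := exists_cell_density (klein_ball h) (klein_hconv_subset hX).
  by rewrite (bigD1 k)//= leeDl// sume_ge0.
rewrite ge0_integral_sum//; last first.
  move=> k; apply/measurable_EFinP.
  exact: (measurable_cell_density (p k) (measurable_voronoi_gauge p k)).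
apply: (@le_trans _ _ (\sum_(k < N) (2 * 8 ^+ m.+1)%:E)%E).
  apply: lee_sum => k _; 
  by apply: integral_cell_density_le; [exact: (measurable_voronoi_gauge p k)|
    move=> a w; exact: (voronoi_gaugeZ p k)].
by rewrite sumEFin sumr_const card_ord mulr_natr.
Qed.

End HullCovering.

Unset Implicit Arguments.

Theorem theorem1p1 (R : realType) (n : nat) (n_ge2 : (2 <= n)%N) :
  exists C : R, 0 < C /\
    forall (N : nat) (x : 'I_N -> hyperbolic R n), (1 <= N)%N ->
      (hvol (hconv (range x)) < (C * N%:R)%:E)%E.
Proof.
case: n n_ge2 => [|[|m]]// _.
(* The extra 1 makes the inequality strict, as [N] is positive. *)
exists (2 * 8 ^+ m.+1 + 1); split; first by rewrite ltr_wpDl// mulr_ge0// exprn_ge0.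
move=> N x N1; apply: (le_lt_trans (hvol_hconv_le x)).
by rewrite lte_fin ltr_pM2r ?ltr0n// ltrDl.
Qed.
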